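(* Let $\sigma^2>0$. Consider the discrete-time memoryless channel with one-bit output quantization: for a Borel set $\mathcal{D}\subset\mathbb{R}$ (the quantization region), an input $x_k\in\mathbb{R}$ at time $k$ produces $\tilde Y_k=x_k+Z_k$ and output $Y_k=1$ if $\tilde Y_k\in\mathcal{D}$ and $Y_k=-1$ otherwise, where $Z_1,Z_2,\dots$ are i.i.d. Gaussian with mean $0$ and variance $\sigma^2$. Then the capacity per unit-energy of this channel (with the quantization region allowed to be optimized) is $$\dot C(0)=\frac{1}{2\sigma^2}.$$ Moreover, this value is achieved using threshold quantization regions: writing $P_{Y|X=x}^{\Upsilon}$ for the output distribution when the input is $x$ and $\mathcal{D}=\{\tilde y\in\mathbb{R}:\tilde y\ge \Upsilon\}$, i.e. $P(Y=1\mid X=x)=Q\bigl((\Upsilon-x)/\sigma\bigr)$, we have $$\sup_{\xi\neq 0,\ \Upsilon\in\mathbb{R}}\frac{D\bigl(P^{\Upsilon}_{Y|X=\xi}\,\big\|\,P^{\Upsilon}_{Y|X=0}\bigr)}{\xi^2}=\frac{1}{2\sigma^2}.$$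
   Context: $Q(x)=\frac{1}{\sqrt{2\pi}}\int_x^\infty e^{-t^2/2}\,dt$ is the Gaussian $Q$-function; $\log$ is the natural logarithm; $D(\cdot\|\cdot)$ is relative entropy. A message $M$ uniform on $\{1,\dots,\mathsf{M}\}$ is encoded into $x_1,\dots,x_n$ satisfying the energy constraint $\sum_{k=1}^n x_k^2\le \mathsf{E}$ for every message; the decoder sees $Y_1,\dots,Y_n$ and outputs $\hat M$. A rate per unit-energy $\dot R$ (nats per unit energy) is achievable if for every $\epsilon>0$ there exist an encoder, a quantization region $\mathcal{D}$ and a decoder with $\log\mathsf{M}/\mathsf{E}>\dot R-\epsilon$ and $\Pr(\hat M\neq M)\to 0$ as $\mathsf{E}\to\infty$. The capacity per unit-energy $\dot C(0)$ is the supremum of achievable rates per unit-energy. *)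

(* Defs.v *)
From HB Require Import structures.
From mathcomp Require Import all_boot all_order all_algebra.
From mathcomp Require Import all_classical all_reals all_analysis.
Set Implicit Arguments. Unset Strict Implicit. Unset Printing Implicit Defensive.
Import Order.TTheory GRing.Theory Num.Theory.
Import numFieldNormedType.Exports.
Local Open Scope classical_set_scope.
Local Open Scope ring_scope.

Section onebit.
Variable R : realType.

(* Pr(Y = 1 | X = x) for the channel with quantization region D and Gaussian
   noise of standard deviation sigma (variance sigma^2):
   Y = 1 iff x + Z in D, and x + Z ~ N(x, sigma^2). *)
Definition prY1 (sigma : R) (D : set R) (x : R) : R :=
  fine (normal_prob x sigma D).

Definition chanW (sigma : R) (D : set R) (x : R) (y : bool) : R :=
  if y then prY1 sigma D x else 1 - prY1 sigma D x.

Record code := Code {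
  blen : nat;
  nmsg : nat;
  nmsg_gt0 : (0 < nmsg)%N;
  region : set R;
  region_meas : measurable region;
  enc : 'I_nmsg -> 'I_blen -> R;
  dec : {ffun 'I_blen -> bool} -> 'I_nmsg }.
Arguments enc : clear implicits.
Arguments dec : clear implicits.

Definition energy_ok (c : code) (E : R) : Prop :=
  forall m : 'I_(nmsg c), \sum_(k < blen c) (enc c m k) ^+ 2 <= E.

Definition perr (sigma : R) (c : code) : R :=
  (nmsg c)%:R^-1 * \sum_(m : 'I_(nmsg c))
     \sum_(y : {ffun 'I_(blen c) -> bool} | dec c y != m)
        \prod_(k < blen c) chanW sigma (region c) (enc c m k) (y k).

Definition achievable (sigma : R) (Rdot : R) : Prop :=
  forall eps : R, 0 < eps ->
  exists c : R -> code,
    (forall E : R, 0 < E ->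
        energy_ok (c E) E /\ Rdot - eps < ln ((nmsg (c E))%:R) / E) /\
    (perr sigma (c E) @[E --> +oo] --> 0).

Definition capacity_set (sigma : R) : set R := [set r | achievable sigma r].

Definition binD (p q : R) : R :=
  p * ln (p / q) + (1 - p) * ln ((1 - p) / (1 - q)).

Definition thr_region (Ups : R) : set R := [set y | Ups <= y].

Definition thr_ratio (sigma xi Ups : R) : R :=
  binD (prY1 sigma (thr_region Ups) xi) (prY1 sigma (thr_region Ups) 0) / xi ^+ 2.

Definition thr_ratios (sigma : R) : set R :=
  [set r | exists xi Ups : R, xi != 0 /\ r = thr_ratio sigma xi Ups].

Definition is_sup (S : set R) (C : R) : Prop :=
  ubound S C /\ (forall b, ubound S b -> C <= b).

End onebit.

(* Main.v *)
(* Write [snr x = x^2 / (2 sigma^2)], the divergence between Gaussians of means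
   [x] and [0].

   Achievability: message [m] puts the whole energy in one pulse of height
   [xi = sqrt E] at time [m], and the threshold is [(1 - d) xi]. The pulse is
   missed with probability at most [expR (- d^2 snr xi)], and each of the other
   positions gives a false alarm with probability at most
   [expR (- (1 - d)^2 snr xi)], so about [expR ((1 - d)^2 snr xi)] messages are
   supported. The same two tail bounds drive [thr_ratio] to its supremum.

   Converse: by data processing a channel use of input [x] has divergence at most
   [snr x] from the zero input, whatever the region. With [A m] the decoding
   region of message [m] and [s = ln M], the Donsker-Varadhan inequality for the
   function [s 1_(A m)] gives
   [s P_m(A m) <= E / (2 sigma^2) + M P_0(A m)]; averaging over [m] yields
   [(1 - perr) ln M - 1 <= E / (2 sigma^2)]. *)
Require Import Defs.
From HB Require Import structures.
From mathcomp Require Import all_boot all_order all_algebra.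
From mathcomp Require Import all_classical all_reals all_analysis.
From mathcomp Require Import ring lra.
Import Order.TTheory GRing.Theory Num.Theory.
Local Open Scope classical_set_scope.
Local Open Scope ring_scope.

Set Implicit Arguments. Unset Strict Implicit. Unset Printing Implicit Defensive.

(** * Logarithms of likelihood ratios *)

Lemma expR_ln_div {R : realType} (p q : R) :
  0 < p -> 0 < q -> expR (ln (p / q)) = p / q.
Proof. by move=> p0 q0; rewrite lnK // posrE divr_gt0. Qed.

(** The choice [t = ln (p / q)] turns [expR t * q] into [p]. For fixed [t] the hypothesis is linear
    in [p], [q] and [r], so it can be obtained by integrating an inequality of densities. *)
Lemma mul_ln_div_tangent {R : realType} (p q a r : R) :
  0 <= p -> 0 <= q -> 0 <= r -> (q = 0 -> p = 0) ->
  (forall t, (t + a) * p <= expR t * q + r) ->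
  p * ln (p / q) + a * p <= p + r.
Proof.
move=> p0 q0 r0 pq0 tangent; have [->|pn] := eqVneq p 0.
  by rewrite mul0r mulr0 !add0r.
have qn : q != 0 by apply: contra_neq pn.
have := tangent (ln (p / q)).
by rewrite expR_ln_div ?lt_def ?pn ?qn // divfK // mulrDl mulrC.
Qed.

(** * Product laws on finite output words and change of measure *)

Section ProductLaw.
Context {R : realType} {I J : finType}.
Implicit Types (W P Q : I -> J -> R) (y : {ffun I -> J}).

Definition prod_law W y : R := \prod_k W k (y k).

(** A term with [q j = 0] evaluates to 0, not to infinity, so this is the relative entropy only when
    [q] dominates [p]. *)
Definition relent (p q : J -> R) : R := \sum_j p j * ln (p j / q j).

Lemma prod_law_ge0 W y : (forall k j, 0 <= W k j) -> 0 <= prod_law W y.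
Proof. by move=> W0; apply: prodr_ge0. Qed.

Lemma sum_prod_law W : (forall k, \sum_j W k j = 1) ->
  \sum_y prod_law W y = 1.
Proof. by move=> W1; rewrite -bigA_distr_bigA big1. Qed.

Lemma sum_prod_law_coord W (i : I) (g : J -> R) :
  (forall k, \sum_j W k j = 1) ->
  \sum_y prod_law W y * g (y i) = \sum_j W i j * g j.
Proof.
move=> W1.
transitivity (\sum_(y : {ffun I -> J}) \prod_k (W k (y k) * (if k == i then g (y k) else 1))).
  by apply: eq_bigr => y _; rewrite big_split /= -big_mkcond big_pred1_eq.
rewrite -(bigA_distr_bigA (fun k j => W k j * (if k == i then g j else 1))) /=.
rewrite (bigD1 i) //= eqxx [X in _ * X]big1 ?mulr1 // => k ki.
by rewrite -[RHS](W1 k); apply: eq_bigr => j _; rewrite (negbTE ki) mulr1.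
Qed.

(* Pointwise form of the Donsker-Varadhan bound
   [E_P f <= D(P || Q) + E_Q (expR f) - 1] with [f = s 1_A]. *)
Lemma change_of_measure P Q (A : pred {ffun I -> J}) (s : R) :
  (forall k j, 0 <= P k j) -> (forall k j, 0 <= Q k j) ->
  (forall k, \sum_j P k j = 1) -> (forall k, \sum_j Q k j = 1) ->
  (forall k j, Q k j = 0 -> P k j = 0) ->
  s * \sum_(y | A y) prod_law P y <=
  \sum_k relent (P k) (Q k) + expR s * \sum_(y | A y) prod_law Q y.
Proof.
move=> P0 Q0 P1 Q1 dom.
pose L y := \sum_k ln (P k (y k) / Q k (y k)).
have pointwise y : s * (if A y then prod_law P y else 0) + prod_law P y <=
    prod_law P y * L y + prod_law Q y
    + expR s * (if A y then prod_law Q y else 0).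
  have Qy := prod_law_ge0 y Q0.
  have [Py|Py] := eqVneq (prod_law P y) 0.
    rewrite Py if_same mulr0 mul0r !add0r addr_ge0 // mulr_ge0 ?expR_ge0 //.
    by case: ifP.
  have Pk k : P k (y k) != 0 by move/prodf_neq0: Py => /(_ k); apply.
  have Qk k : Q k (y k) != 0 by apply: contra_neq (Pk k); exact: dom.
  have QE : prod_law Q y = prod_law P y * expR (- L y).
    rewrite /L -sumrN expR_sum -big_split /=; apply: eq_bigr => k _.
    rewrite expRN expR_ln_div ?lt_def ?Pk ?Qk ?P0 ?Q0 //.
    by rewrite invf_div mulrC divfK.
  have Pp := prod_law_ge0 y P0.
  (* The tangent line of [expR] at 0 is evaluated at [s - L y] on [A] and at [- L y] off [A]; on [A]
     the summand [prod_law Q y] is nonnegative slack. *)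
  case: (A y).
    have := ler_wpM2l Pp (expR_ge1Dx (s - L y)); rewrite expRD QE.
    by have := mulr_ge0 Pp (expR_ge0 (- L y)); lra.
  by have := ler_wpM2l Pp (expR_ge1Dx (- L y)); rewrite QE; lra.
have : \sum_y (s * (if A y then prod_law P y else 0) + prod_law P y) <=
    \sum_y (prod_law P y * L y + prod_law Q y
              + expR s * (if A y then prod_law Q y else 0)).
  by apply: ler_sum => y _; exact: pointwise.
rewrite !big_split /= -!mulr_sumr -!big_mkcond !sum_prod_law //.
suff -> : \sum_y prod_law P y * L y = \sum_k relent (P k) (Q k) by lra.
rewrite /L; under eq_bigr do rewrite mulr_sumr.
rewrite exchange_big /=; apply: eq_bigr => k _.
exact: (sum_prod_law_coord k (fun j => ln (P k j / Q k j)) P1).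
Qed.

End ProductLaw.

(** * Output probabilities of one channel use *)

Section OneBit.
Context {R : realType}.

Variables (sigma : R) (sigma_gt0 : 0 < sigma).
Implicit Types (x : R) (D : set R) (b : bool).

Lemma prY1_ge0 D x : 0 <= prY1 sigma D x.
Proof. by rewrite /prY1 fine_ge0 // measure_ge0. Qed.

Lemma prY1_fin_num D x : measurable D -> normal_prob x sigma D \is a fin_num.
Proof. by move=> mD; exact: fin_num_measure. Qed.

Lemma prY1_le1 D x : measurable D -> prY1 sigma D x <= 1.
Proof.
move=> mD; rewrite -lee_fin /prY1 fineK ?prY1_fin_num //.
exact: probability_le1.
Qed.

Lemma prY1_setC D x : measurable D -> prY1 sigma (~` D) x = 1 - prY1 sigma D x.
Proof.
move=> mD; rewrite /prY1.
have -> : normal_prob x sigma (~` D) = (1 - normal_prob x sigma D)%E.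
  exact: probability_setC.
by rewrite fineB ?prY1_fin_num.
Qed.

Lemma chanWE D x b : measurable D ->
  chanW sigma D x b = prY1 sigma (if b then D else ~` D) x.
Proof. by move=> mD; case: b => //; rewrite prY1_setC. Qed.

Lemma chanW_ge0 D x b : measurable D -> 0 <= chanW sigma D x b.
Proof. by move=> mD; rewrite chanWE ?prY1_ge0. Qed.

Lemma chanW_neq0_gt0 D x b :
  measurable D -> chanW sigma D x b != 0 -> 0 < chanW sigma D x b.
Proof. by move=> mD Wx; rewrite lt_def Wx chanW_ge0. Qed.

Lemma sum_chanW D x : \sum_b chanW sigma D x b = 1.
Proof. by rewrite big_bool /= addrC subrK. Qed.

Lemma ler_prY1 D (x y z a c d : R) : measurable D ->
  (forall w, D w -> a * normal_pdf x sigma w <=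
     c * normal_pdf y sigma w + d * normal_pdf z sigma w) ->
  a * prY1 sigma D x <= c * prY1 sigma D y + d * prY1 sigma D z.
Proof.
move=> mD le_pdf.
pose mu := @lebesgue_measure R.
have iN m : mu.-integrable D (EFin \o normal_pdf m sigma).
  by apply: integrableS (integrable_normal_pdf m sigma).
have iZ m k : mu.-integrable D (EFin \o (fun w => k * normal_pdf m sigma w)).
  exact: (@integrableZl _ _ _ mu D mD k _ (iN m)).
have ZE m k : k * prY1 sigma D m = Rintegral mu D (fun w => k * normal_pdf m sigma w).
  exact/esym/(@RintegralZl _ _ _ mu D _ k mD (iN m)).
rewrite !ZE -(@RintegralD _ _ _ mu D _ _ mD (iZ y c) (iZ z d)).
apply: (@le_Rintegral _ _ _ mu D _ _ mD (iZ x a)) => //.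
exact: (@integrableD _ _ _ mu D mD _ _ (iZ y c) (iZ z d)).
Qed.

(** * Divergence of one channel use, for an arbitrary region *)

Definition snr x : R := x ^+ 2 / (2 * sigma ^+ 2).

Lemma snr_ge0 x : 0 <= snr x.
Proof. by rewrite divr_ge0 ?sqr_ge0 // mulr_ge0 ?ler0n ?sqr_ge0. Qed.

(* The log-likelihood ratio is [L w = snr x + a / h] with [a = h x (w - x) / sigma^2].
   The bounds [t - L <= expR (t - L) - 1] and [a <= expR a - 1] make both sides
   combinations of Gaussian densities, so that no Gaussian moment is needed. *)
Lemma normal_pdf_tangent x t h w : 0 < h ->
  (t + 1 - snr x + h^-1) * normal_pdf x sigma w <=
  expR t * normal_pdf 0 sigma w
    + h^-1 * expR (h ^+ 2 * snr x) * normal_pdf (x + h * x) sigma w.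
Proof.
move=> h_gt0; have s0 : sigma != 0 by rewrite gt_eqF.
rewrite !normal_pdfE //; set K := normal_peak sigma.
pose a := h * x * (w - x) / sigma ^+ 2.
pose e := normal_fun x sigma w.
have -> : normal_fun 0 sigma w = e * expR (- (snr x + a / h)).
  rewrite /e /normal_fun -expRD /snr /a; congr expR.
  by field; rewrite s0 gt_eqF.
have e2E : expR (h ^+ 2 * snr x) * normal_fun (x + h * x) sigma w = e * expR a.
  by rewrite /e /normal_fun -!expRD /snr /a; congr expR; field; rewrite s0.
have Ke : 0 <= K * e by rewrite mulr_ge0 ?normal_peak_ge0 ?expR_ge0.
have -> : h^-1 * expR (h ^+ 2 * snr x) * (K * normal_fun (x + h * x) sigma w)
          = (K * e) * (h^-1 * expR a).
  by rewrite [RHS]mulrACA -e2E; ring.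
have -> : expR t * (K * (e * expR (- (snr x + a / h))))
          = (K * e) * expR (t - (snr x + a / h)).
  by rewrite expRD; ring.
rewrite -mulrDr mulrC ler_wpM2l //.
have := expR_ge1Dx (t - (snr x + a / h)).
have : h^-1 * (1 + a) <= h^-1 * expR a.
  by apply: ler_wpM2l (expR_ge1Dx a); rewrite invr_ge0 ltW.
lra.
Qed.

Lemma chanW_tangent D x b t h : measurable D -> 0 < h ->
  (t + 1 - snr x + h^-1) * chanW sigma D x b <=
  expR t * chanW sigma D 0 b
    + h^-1 * expR (h ^+ 2 * snr x) * chanW sigma D (x + h * x) b.
Proof.
move=> mD h_gt0; rewrite !chanWE //; apply: ler_prY1 => [|w _].
  by case: b => //; exact: measurableC.
exact: normal_pdf_tangent.
Qed.

(** If the zero-input probability vanishes, the right side of [chanW_tangent] is constant in [t]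
    while the left side is linear in [t] with slope [chanW sigma D x b]; a large [t] excludes a
    positive slope. *)
Lemma chanW_dominated D x b : measurable D ->
  chanW sigma D 0 b = 0 -> chanW sigma D x b = 0.
Proof.
move=> mD W0; apply/eqP/contraT => Wx.
have {}Wx := chanW_neq0_gt0 mD Wx.
set r := chanW sigma D (x + 1 * x) b.
pose t := snr x - 1 + expR (snr x) * r / chanW sigma D x b.
have := @chanW_tangent D x b t 1 mD ltr01.
rewrite W0 mulr0 add0r invr1 mul1r expr1n mul1r -/r /t.
rewrite [X in X * _](_ : _ = 1 + expR (snr x) * r / chanW sigma D x b); last by ring.
by rewrite mulrDl mul1r divfK ?gt_eqF // gerDr leNgt Wx.
Qed.

Lemma binD_relent D x : binD (prY1 sigma D x) (prY1 sigma D 0) =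
  relent (chanW sigma D x) (chanW sigma D 0).
Proof. by rewrite /relent big_bool. Qed.

(** Summing the tangent bounds over both outputs gives [snr x] plus an excess
    [h^-1 * (expR (h ^+ 2 * snr x) - 1)], which vanishes as [h] tends to 0. *)
Lemma binD_le_snr D x : measurable D ->
  binD (prY1 sigma D x) (prY1 sigma D 0) <= snr x.
Proof.
move=> mD; rewrite binD_relent.
set S := relent _ _.
have := snr_ge0 x; set c := snr x => c0.
have bound h : 0 < h -> S <= c + h^-1 * (expR (h ^+ 2 * c) - 1).
  move=> h0; set K := h^-1 * expR (h ^+ 2 * c).
  have K0 : 0 <= K by rewrite mulr_ge0 ?expR_ge0 // invr_ge0 ltW.
  pose a := 1 - c + h^-1.
  have : S + a <= 1 + K.
    rewrite -(sum_chanW D x) -[in X in _ <= _ + X](mulr1 K) -(sum_chanW D (x + h * x)).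
    rewrite -[X in S + X]mulr1 -[in X in S + X](sum_chanW D x).
    rewrite !mulr_sumr -!big_split /=; apply: ler_sum => b _.
    apply: mul_ln_div_tangent => [||||t].
    - exact: chanW_ge0.
    - exact: chanW_ge0.
    - by apply: mulr_ge0 K0 _; exact: chanW_ge0.
    - exact: chanW_dominated.
    - by rewrite /a !addrA; exact: chanW_tangent.
  by rewrite /a /K; lra.
apply/ler_addgt0Pr => e e0.
(* The excess is at most [h * c * expR c], using [h <= 1]; the [+ 1] keeps the denominator positive
   when [c = 0]. *)
pose h := Num.min 1 (e / (c * expR c + 1)).
have d0 : 0 < c * expR c + 1 by rewrite ltr_wpDl // mulr_ge0 // expR_ge0.
have h0 : 0 < h by rewrite lt_min ltr01 divr_gt0.
have h1 : h <= 1 by rewrite ge_min lexx.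
have he : h * (c * expR c + 1) <= e by rewrite -ler_pdivlMr // ge_min lexx orbT.
apply: le_trans (bound h h0) _; rewrite lerD2l.
rewrite ler_pdivrMl //.
pose u := h ^+ 2 * c.
have u0 : 0 <= u by rewrite mulr_ge0 // sqr_ge0.
have uc : u <= c by rewrite ler_piMl // expr_le1 // ltW.
have e1 : expR u - 1 <= u * expR c.
  have := expR_ge1Dx (- u); rewrite expRN.
  have : expR u <= expR c by rewrite ler_expR.
  have := expR_gt0 u; set E := expR u => E0 Ec.
  have : E * E^-1 = 1 by rewrite divff // gt_eqF.
  nra.
rewrite -/u; apply: le_trans e1 _; rewrite /u.
have := expR_gt0 c; nra.
Qed.

(** * Gaussian tail bounds for threshold regions *)

(** Moving the mean from [x] to [u] costs the factor [expR (- snr (x - u))] up to the exponential of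
    a cross term in [(x - u) * (w - u)], whose sign is the hypothesis; the mass left under mean [u]
    is at most 1. *)
Lemma prY1_tail D x u : measurable D ->
  (forall w, D w -> (x - u) * (w - u) <= 0) ->
  prY1 sigma D x <= expR (- snr (x - u)).
Proof.
move=> mD Du; have s0 : sigma != 0 by rewrite gt_eqF.
have := @ler_prY1 D x u u 1 (expR (- snr (x - u))) 0 mD.
rewrite mul1r mul0r addr0 => /(_ _)/le_trans; apply => [w Dw|].
  rewrite mul1r mul0r addr0 !normal_pdfE // mulrCA.
  apply: ler_wpM2l; first exact: normal_peak_ge0.
  rewrite /normal_fun -expRD ler_expR /snr -subr_ge0.
  rewrite [X in 0 <= X](_ : _ = - ((x - u) * (w - u)) / sigma ^+ 2); last first.
    by field; rewrite s0.
  by rewrite divr_ge0 ?sqr_ge0 // oppr_ge0 Du.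
by rewrite ler_piMr ?expR_ge0 // prY1_le1.
Qed.

Lemma measurable_thr_region (u : R) : measurable (thr_region u).
Proof.
rewrite (_ : thr_region u = `[u, +oo[%classic) //.
by apply/seteqP; split => w /=; rewrite in_itv /= andbT.
Qed.

Lemma threshold_false_alarm (u : R) : 0 <= u ->
  prY1 sigma (thr_region u) 0 <= expR (- snr u).
Proof.
move=> u0; have -> : snr u = snr (0 - u) by rewrite /snr sub0r sqrrN.
apply: prY1_tail => [|w]; first exact: measurable_thr_region.
by rewrite /thr_region /= => uw; nra.
Qed.

Lemma threshold_miss (u x : R) : u <= x ->
  1 - prY1 sigma (thr_region u) x <= expR (- snr (x - u)).
Proof.
move=> ux; rewrite -prY1_setC; last exact: measurable_thr_region.
apply: prY1_tail => [|w]; first by apply: measurableC; exact: measurable_thr_region.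
by move/negP; rewrite -ltNge => wu; nra.
Qed.

(** * Converse bound for a single code *)

Lemma perr_ln_nmsg_le (c : Defs.code R) (E : R) : energy_ok c E ->
  (1 - perr sigma c) * ln (nmsg c)%:R - 1 <= E / (2 * sigma ^+ 2).
Proof.
move=> cE; set M := (nmsg c)%:R : R.
have M0 : 0 < M by rewrite ltr0n; exact: nmsg_gt0.
have mD := region_meas c.
pose P m := prod_law (fun k => chanW sigma (region c) (@enc _ c m k)).
pose Q := prod_law (fun _ : 'I_(blen c) => chanW sigma (region c) 0).
have perrE : \sum_m \sum_(y | @dec _ c y == m) P m y = M * (1 - perr sigma c).
  rewrite mulrBr mulr1 /perr mulrA divff ?gt_eqF // mul1r.
  apply/eqP; rewrite eq_sym subr_eq -big_split /=; apply/eqP.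
  transitivity (\sum_(m < nmsg c) \sum_y P m y).
    rewrite (eq_bigr (fun=> 1)) => [|m _]; first by rewrite sumr_const card_ord.
    by apply: sum_prod_law => k; exact: sum_chanW.
  by apply: eq_bigr => m _; rewrite (bigID (fun y => @dec _ c y == m)).
(* The decoding regions partition the output words, and [Q] is the same for all messages. After
   averaging, this total mass is the [1] subtracted in the conclusion. *)
have QE : \sum_(m < nmsg c) \sum_(y | @dec _ c y == m) Q y = 1.
  transitivity (\sum_y Q y); last by apply: sum_prod_law => k; exact: sum_chanW.
  by rewrite [RHS](partition_big (@dec _ c) xpredT).
have cm m : ln M * \sum_(y | @dec _ c y == m) P m y <=
    E / (2 * sigma ^+ 2) + M * \sum_(y | @dec _ c y == m) Q y.
  rewrite -{2}(lnK M0).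
  have /le_trans := @change_of_measure _ _ _
    (fun k => chanW sigma (region c) (@enc _ c m k))
    (fun=> chanW sigma (region c) 0) (fun y => @dec _ c y == m) (ln M)
    (fun k b => chanW_ge0 _ b mD) (fun k b => chanW_ge0 _ b mD)
    (fun k => sum_chanW _ _) (fun k => sum_chanW _ _)
    (fun k b => chanW_dominated _ mD).
  apply; rewrite lerD2r.
  apply: (@le_trans _ _ (\sum_k snr (@enc _ c m k))).
    by apply: ler_sum => k _; rewrite -binD_relent; exact: binD_le_snr.
  rewrite /snr -mulr_suml; apply: ler_wpM2r (cE m).
  by rewrite invr_ge0 mulr_ge0 // sqr_ge0.
clearbody P Q; move: (perr sigma c) perrE => e perrE.
have : \sum_(m < nmsg c) ln M * \sum_(y | @dec _ c y == m) P m y <=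
    \sum_(m < nmsg c) (E / (2 * sigma ^+ 2) + M * \sum_(y | @dec _ c y == m) Q y).
  by apply: ler_sum => m _; exact: cm.
rewrite big_split /= -!mulr_sumr perrE QE sumr_const card_ord -mulr_natl -/M.
by move=> H; rewrite -(ler_pM2l M0); move: H; lra.
Qed.

(** * Pulse position modulation *)

(** The noiseless output at slot [k] is [k == m], so [k != m] is the erroneous one: a miss at the
    pulse, a false alarm elsewhere. *)
Lemma chanW_pulse_error (n : nat) (xi u : R) (m k : 'I_n.+1) :
  chanW sigma (thr_region u) (if k == m then xi else 0) (k != m) =
  if k == m then 1 - prY1 sigma (thr_region u) xi else prY1 sigma (thr_region u) 0.
Proof. by case: (k == m). Qed.

(** One slot per message, with [n.+1] slots so that the message set is nonempty. [ord0] is an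
    arbitrary answer when no slot outputs 1. *)
Definition pulse_position_code (xi u : R) (n : nat) : Defs.code R :=
  @Code R n.+1 n.+1 (ltn0Sn n) (thr_region u) (measurable_thr_region u)
    (fun m k => if k == m then xi else 0)
    (fun y => odflt ord0 [pick k | y k]).

Lemma energy_pulse_position (xi u : R) (n : nat) :
  energy_ok (pulse_position_code xi u n) (xi ^+ 2).
Proof.
move=> m; rewrite /= (bigD1 m) //= eqxx big1 ?addr0 // => k km.
by rewrite (negbTE km) expr0n.
Qed.

Lemma perr_ge0 (c : Defs.code R) : 0 <= perr sigma c.
Proof.
rewrite mulr_ge0 ?invr_ge0 ?ler0n // sumr_ge0 // => m _.
rewrite sumr_ge0 // => y _; rewrite prodr_ge0 // => k _.
exact: chanW_ge0 (region_meas c).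
Qed.

(** Union bound over slots: decoding can fail only if some slot differs from its noiseless
    output. *)
Lemma perr_pulse_position (xi u : R) (n : nat) :
  perr sigma (pulse_position_code xi u n) <=
  1 - prY1 sigma (thr_region u) xi + n.+1%:R * prY1 sigma (thr_region u) 0.
Proof.
set c := pulse_position_code xi u n; set p := prY1 _ _ xi; set q := prY1 _ _ 0.
have mD := measurable_thr_region u.
have q0 : 0 <= q := prY1_ge0 _ _.
set B := 1 - p + _; rewrite /perr ler_pdivrMl ?ltr0n //.
apply: (@le_trans _ _ (\sum_(m < n.+1) B)); last by rewrite sumr_const card_ord mulr_natl.
apply: ler_sum => m _.
pose W (k : 'I_n.+1) := chanW sigma (thr_region u) (if k == m then xi else 0).
have W0 k b : 0 <= W k b by exact: chanW_ge0.
have W1 k : \sum_b W k b = 1 by exact: sum_chanW.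
have WE k : W k (k != m) = if k == m then 1 - p else q by exact: chanW_pulse_error.
have dec_correct (y : {ffun 'I_n.+1 -> bool}) :
    (forall k, y k = (k == m)) -> @dec _ c y = m.
  move=> yE; rewrite /=; case: pickP => [k|/(_ m)]; rewrite yE ?eqxx //.
  by move/eqP.
have union_bound (y : {ffun 'I_n.+1 -> bool}) :
    (if @dec _ c y != m then prod_law W y else 0)
    <= \sum_k prod_law W y * (y k != (k == m))%:R.
  have Wy : 0 <= prod_law W y := prod_law_ge0 y W0.
  case: ifPn => [wrong|_]; last by rewrite sumr_ge0 // => k _; rewrite mulr_ge0.
  have /existsP[k yk] : [exists k, y k != (k == m)].
    by apply: contraR wrong => /existsPn yE; apply/eqP/dec_correct => k; apply/eqP/negPn.
  rewrite (bigD1 k) //= yk mulr1 lerDl sumr_ge0 // => j _.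
  by rewrite mulr_ge0.
rewrite big_mkcond; apply: (@le_trans _ _ (\sum_k W k (k != m))).
  apply: (@le_trans _ _ (\sum_y \sum_k prod_law W y * (y k != (k == m))%:R)).
    by apply: ler_sum => y _; exact: union_bound.
  clearbody W; rewrite exchange_big /=; apply: ler_sum => k _.
  rewrite (sum_prod_law_coord k (fun b => (b != (k == m))%:R) W1) big_bool /=.
  move: (W k) => w; case: (k == m) => /=.
    by rewrite mulr0n mulr0 add0r mulr1.
  by rewrite mulr0n mulr0 addr0 mulr1.
rewrite (eq_bigr _ (fun k _ => WE k)) (bigD1 m) //= eqxx.
rewrite lerD2l.
rewrite (eq_bigr (fun=> q)) => [|k /negbTE -> //].
(* The number of slots other than [m] is rounded up to [n.+1]. *)
rewrite sumr_const mulr_natl; apply: ler_wpMn2l => //.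
by rewrite (leq_trans (max_card _)) ?card_ord.
Qed.

End OneBit.

(** * Elementary estimates for achievability *)

Lemma expRN_le_inv {R : realType} (a : R) : 0 < a -> expR (- a) <= a^-1.
Proof.
move=> a0; rewrite expRN lef_pV2 ?posrE ?expR_gt0 //.
by apply: le_trans (expR_ge1Dx a); rewrite lerDr.
Qed.

Lemma mul_ln_div_ge {R : realType} (x y : R) :
  0 <= x -> 0 < y -> x - y <= x * ln (x / y).
Proof.
move=> x0 y0; have [->|xn] := eqVneq x 0; first by rewrite mul0r sub0r oppr_le0 ltW.
have xp : 0 < x by rewrite lt_def xn.
have := expR_ge1Dx (- ln (x / y)).
rewrite expRN expR_ln_div // invf_div => /(ler_wpM2l x0).
by rewrite mulrA [x * y]mulrC mulfK //; lra.
Qed.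

(** The part [p * - ln q] is at least [p * s]; by [mul_ln_div_ge] the rest is at least [q - 1],
    hence at least [-1]. *)
Lemma binD_ge {R : realType} (p q s : R) :
  0 <= p <= 1 -> 0 < q < 1 -> q <= expR (- s) -> p * s - 1 <= binD p q.
Proof.
move=> /andP[p0 p1] /andP[q0 q1] qs.
have lnq : s <= - ln q.
  by rewrite lerNr -(expRK (- s)) ler_ln ?posrE ?expR_gt0.
have p1' : 0 <= 1 - p by rewrite subr_ge0.
have q1' : 0 < 1 - q by rewrite subr_gt0.
have := mul_ln_div_ge p1' q1'; rewrite /binD.
suff : p * s + p - 1 <= p * ln (p / q) by lra.
have [->|pn] := eqVneq p 0; first by rewrite !mul0r; lra.
have pp : 0 < p by rewrite lt_def pn.
have := mul_ln_div_ge p0 ltr01; rewrite divr1 ln_div ?posrE //.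
by have := ler_wpM2l p0 lnq; lra.
Qed.

Lemma exists_backoff {R : realType} (C b : R) : 0 < C -> b < C ->
  (* With [d * C <= (C - b) / 4], [(1 - d) ^+ 2 * C >= C - 2 * d * C >= (C + b) / 2 > b]. *)
  exists d : R, [/\ 0 < d, d < 1 & b < (1 - d) ^+ 2 * C].
Proof.
move=> C0 bC; exists (Num.min 2^-1 ((C - b) / (4 * C))).
set e := (C - b) / (4 * C).
have e0 : 0 < e by rewrite divr_gt0 ?mulr_gt0 ?subr_gt0.
have eC : e * C = (C - b) / 4 by rewrite /e; field; rewrite gt_eqF.
set d := Num.min _ _.
have d0 : 0 < d by rewrite lt_min invr_gt0 ltr0n.
have de : d <= e by rewrite ge_min lexx orbT.
have d2 : d <= 2^-1 by rewrite ge_min lexx.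
split => //; first by lra.
have := ler_wpM2r (ltW C0) de; rewrite eC.
have : 0 <= d ^+ 2 * C by rewrite mulr_ge0 ?sqr_ge0 // ltW.
by rewrite !expr2; lra.
Qed.

(** * Capacity and the supremum over thresholds *)

Section Capacity.
Context {R : realType}.
Variables (sigma : R) (sigma_gt0 : 0 < sigma).
Let C : R := (2 * sigma ^+ 2)^-1.

Let C_gt0 : 0 < C.
Proof. by rewrite invr_gt0 mulr_gt0 // exprn_gt0. Qed.

Section Pulse.
Variables (d E : R) (d0 : 0 < d) (d1 : d < 1) (E0 : 0 < E).
Let xi : R := Num.sqrt E.
Let u : R := (1 - d) * xi.
Let p := prY1 sigma (thr_region u) xi.
Let q := prY1 sigma (thr_region u) 0.

Lemma pulse_false_alarm : q <= expR (- ((1 - d) ^+ 2 * C * E)).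
Proof.
have -> : (1 - d) ^+ 2 * C * E = snr sigma u.
  by rewrite /snr /u exprMn sqr_sqrtr ?ltW // mulrAC.
apply: threshold_false_alarm => //.
by rewrite mulr_ge0 ?sqrtr_ge0 // subr_ge0 ltW.
Qed.

Lemma pulse_miss : 1 - p <= expR (- (d ^+ 2 * C * E)).
Proof.
have -> : d ^+ 2 * C * E = snr sigma (xi - u).
  rewrite (_ : xi - u = d * xi); last by rewrite /u; ring.
  by rewrite /snr exprMn sqr_sqrtr ?ltW // mulrAC.
apply: threshold_miss => //.
by rewrite /u ler_piMl ?sqrtr_ge0 // gerBl ltW.
Qed.

Lemma binD_pulse_ge : p * ((1 - d) ^+ 2 * C * E) - 1 <= binD p q.
Proof.
have mD := measurable_thr_region u.
have e1 k : 0 < k -> expR (- (k ^+ 2 * C * E)) < 1.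
  by move=> k0; rewrite -expR0 ltr_expR oppr_lt0 !mulr_gt0 ?exprn_gt0.
have p0 : 0 < p by have := pulse_miss; have := e1 d d0; lra.
(* By domination [q = 0] would force [p = 0], against the miss bound. *)
have q0 : q != 0.
  apply: contraTneq p0 => q0.
  have := @chanW_dominated _ _ sigma_gt0 _ xi true mD q0.
  by rewrite /chanW -/p => ->; rewrite ltxx.
apply: binD_ge pulse_false_alarm.
  by rewrite ltW // /p prY1_le1.
rewrite lt_def q0 prY1_ge0 /=; apply: le_lt_trans pulse_false_alarm _.
by apply: e1; rewrite subr_gt0.
Qed.

End Pulse.

Lemma thr_ratio_le (xi u : R) : xi != 0 -> thr_ratio sigma xi u <= C.
Proof.
move=> xi0; have x2 : 0 < xi ^+ 2 by rewrite exprn_even_gt0.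
rewrite /thr_ratio ler_pdivrMr // [C * _]mulrC.
exact: (binD_le_snr sigma_gt0 xi (measurable_thr_region u)).
Qed.

Lemma thr_ratio_gt (b : R) : b < C ->
  exists xi u : R, xi != 0 /\ b < thr_ratio sigma xi u.
Proof.
move=> bC; have [d [d0 d1 bk]] := exists_backoff C_gt0 bC.
set k := (1 - d) ^+ 2 * C in bk.
have k0 : 0 < k by rewrite mulr_gt0 // exprn_gt0 // subr_gt0.
have dC0 : 0 < d ^+ 2 * C by rewrite mulr_gt0 // exprn_gt0.
(* [K] bounds the total loss: [(1 - p) * k * E <= K - 1] by the miss bound, plus the 1 lost in
   [binD_pulse_ge]. The choice of [E] makes the gain [(k - b) * E] equal to [2 * K]. *)
pose K := k / (d ^+ 2 * C) + 1.
have K0 : 0 < K by rewrite addr_gt0 // divr_gt0.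
have kb : 0 < k - b by rewrite subr_gt0.
pose E := 2 * K / (k - b).
have E0 : 0 < E by rewrite divr_gt0 // mulr_gt0.
exists (Num.sqrt E), ((1 - d) * Num.sqrt E).
split; first by rewrite gt_eqF // sqrtr_gt0.
rewrite /thr_ratio sqr_sqrtr ?ltW // ltr_pdivlMr //.
apply: lt_le_trans (binD_pulse_ge d0 d1 E0).
have := le_trans (pulse_miss d0 E0) (expRN_le_inv (mulr_gt0 dC0 E0)).
set p := prY1 _ _ _; rewrite -/k => miss.
have kE0 : 0 < k * E by rewrite mulr_gt0.
have := ler_wpM2r (ltW kE0) miss.
have -> : (d ^+ 2 * C * E)^-1 * (k * E) = K - 1.
  by rewrite /K; field; rewrite !gt_eqF // ?exprn_gt0.
have : E * (k - b) = 2 * K by rewrite /E divfK // gt_eqF.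
by lra.
Qed.

Lemma achievable_max : achievable sigma C.
Proof.
move=> eps eps0.
have bC : C - eps < C by rewrite gtrBl.
have [d [d0 d1 rk]] := exists_backoff C_gt0 bC.
set r := C - eps in rk *; set k := (1 - d) ^+ 2 * C in rk.
(* The code has [(n E).+1 > expR (r * E)] messages, which makes the rate inequality strict. *)
pose n E := Num.trunc (expR (r * E)).
exists (fun E => pulse_position_code (Num.sqrt E) ((1 - d) * Num.sqrt E) (n E)).
have k0 : 0 < k by rewrite mulr_gt0 // exprn_gt0 // subr_gt0.
have dC0 : 0 < d ^+ 2 * C by rewrite mulr_gt0 // exprn_gt0.
have kr0 : 0 < k - r by rewrite subr_gt0.
split=> [E E0|].
  split.
    rewrite -[X in energy_ok _ X](sqr_sqrtr (ltW E0)).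
    exact: energy_pulse_position.
  rewrite ltr_pdivlMr // -[ltLHS]expRK ltr_ln ?posrE ?expR_gt0 ?ltr0n //=.
  exact: truncnS_gt.
(* One summand each for the miss, for the false alarms of [expR (r * E)] slots, and for the one
   further slot due to rounding. *)
pose K := (d ^+ 2 * C)^-1 + (k - r)^-1 + k^-1.
have K0 : 0 < K by rewrite !addr_gt0 ?invr_gt0.
have perr_le E : 0 < E -> perr sigma
    (pulse_position_code (Num.sqrt E) ((1 - d) * Num.sqrt E) (n E)) <= K / E.
  move=> E0; apply: (le_trans (perr_pulse_position sigma _ _ _)).
  have nE : (n E).+1%:R <= expR (r * E) + 1.
    by rewrite -natr1 lerD2r truncn_le expR_ge0.
  have fa := pulse_false_alarm d1 E0; rewrite -/k in fa.
  have := ler_pM (ler0n _ _) (prY1_ge0 _ _ _) nE fa.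
  rewrite [(expR _ + 1) * _]mulrDl mul1r -expRD.
  rewrite (_ : r * E + - (k * E) = - ((k - r) * E)); last by ring.
  have := pulse_miss d0 E0.
  have exp_le a : 0 < a -> expR (- (a * E)) <= a^-1 / E.
    by move=> a0; rewrite -invfM; apply: expRN_le_inv; rewrite mulr_gt0.
  move: (exp_le _ dC0) (exp_le _ kr0) (exp_le _ k0); rewrite /K.
  move: (prY1 _ _ _) (prY1 _ _ _) => p q; lra.
apply/cvgrPdist_lt => e e0; near=> E.
have E0 : 0 < E by near: E; exact: nbhs_pinfty_gt.
rewrite sub0r normrN ger0_norm ?perr_ge0 //.
apply: le_lt_trans (perr_le E E0) _.
rewrite ltr_pdivrMr // -ltr_pdivrMl //.
by near: E; apply: nbhs_pinfty_gt; exact: num_real.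
Unshelve. all: by end_near. Qed.

Lemma achievable_le (r : R) : achievable sigma r -> r <= C.
Proof.
move=> ach; rewrite leNgt; apply/negP => Cr.
pose e := (r - C) / 2.
have e0 : 0 < e by rewrite divr_gt0 // subr_gt0.
have [c [c_ok perr0]] := ach e e0.
have Ce : 0 < C + e by rewrite addr_gt0.
(* The rate exceeds [r - e = C + e], and [eta * (C + e) = e / 2], so the converse bound would give
   [(C + e / 2) * E <= C * E + 1], which fails for [E > 2 / e]. *)
pose eta := e / (2 * (C + e)).
have eta0 : 0 < eta by rewrite divr_gt0 // mulr_gt0.
have [E [E_gt perrE]] : exists E, 2 / e < E /\ perr sigma (c E) < eta.
  move/cvgrPdist_lt: perr0 => /(_ eta eta0) perr0.
  have : \forall E \near +oo, 2 / e < E /\ perr sigma (c E) < eta.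
    near=> E; split; first by near: E; apply: nbhs_pinfty_gt; exact: num_real.
    have : `|0 - perr sigma (c E)| < eta by near: E.
    by rewrite sub0r normrN; apply: le_lt_trans (ler_norm _).
  exact: filter_ex.
have E0 : 0 < E by apply: lt_trans E_gt; rewrite divr_gt0.
have [cE rate] := c_ok E E0.
have := perr_ln_nmsg_le sigma_gt0 cE.
rewrite -/C; set L := ln _ in rate *; set pe := perr _ _ in perrE *.
rewrite ltr_pdivlMr // in rate.
have re : r - e = C + e by rewrite /e; field.
rewrite re in rate.
have L0 : 0 < L by apply: le_lt_trans rate; rewrite mulr_ge0 // ltW.
have etaE : eta * (C + e) = e / 2 by rewrite /eta; field; rewrite gt_eqF.
have eta1 : eta < 1.
  rewrite -(ltr_pM2r Ce) etaE mul1r.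
  by move: C_gt0 e0; clear; move: C e => c' e'; lra.
have eE : 2 < e * E by rewrite mulrC -ltr_pdivrMr.
have : (1 - eta) * ((C + e) * E) <= (1 - pe) * L.
  apply: ler_pM; rewrite ?subr_ge0 ?lerD2l ?lerN2; try exact: ltW.
  by rewrite mulr_ge0 // ltW.
rewrite mulrA mulrBl mul1r etaE; lra.
Unshelve. all: by end_near. Qed.

End Capacity.

Theorem theorem1 (R : realType) (sigma : R) (hsigma : 0 < sigma) :
  is_sup (capacity_set sigma) (1 / (2 * sigma ^+ 2)) /\
  is_sup (thr_ratios sigma) (1 / (2 * sigma ^+ 2)).
Proof.
rewrite div1r; split; split.
- by move=> r; exact: achievable_le.
- by move=> b; apply; exact: achievable_max.
- by move=> _ [xi [u [xi0 ->]]]; exact: thr_ratio_le.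
- move=> b ub; rewrite leNgt; apply/negP => /(thr_ratio_gt hsigma)[xi [u [xi0]]].
  by apply/negP; rewrite -leNgt; apply: ub; exists xi, u.
Qed.
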